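(* Fix a deterministic regime $d$ and a local structural successor family $\mathbf S$ such that the state, treatment and outcome spaces are finite and $\mathcal M(P,G,\mathbf S)\neq\varnothing$. Let $\mathcal Q^{\mathrm{default}}$ be the default family of feasible transition sets constructed from $P$, $G$ and $\mathbf S$. Then the interventional ambiguity set of the default family equals the causal identified set: $$\mathcal P^d(\mathcal Q^{\mathrm{default}})=\mathcal I^d(P,G,\mathbf S).$$
   Context: **Spaces.** Fix $T\ge 1$, finite state spaces $\mathcal S_0,\dots,\mathcal S_T$, a finite treatment space $\mathcal A$, a finite outcome space $\mathcal Y\subseteq\mathbb R$ and a known map $y:\mathcal S_T\to\mathcal Y$. The outcome is $Y=y(S_T)$. Since $Y$ is a function of $S_T$, laws of trajectories are written as laws of $\mathbf v=(s_0,a_0,s_1,\dots,s_{T-1},a_{T-1},s_T)$, the point mass on $Y$ being implicit. $\Delta(X)$ is the set of probability distributions on a finite set $X$; distributions on a subset are extended by zero. **SCMs.** A structural causal model (SCM) $M$ consists of exogenous random variables $\varepsilon_0^S$ and $\varepsilon_t^U,\varepsilon_t^A,\varepsilon_{t+1}^S$ ($t=0,\dots,T-1$) on a common probability space $(\Omega_M,Q_M)$, and (measurable) functions giving $$S_0=f_0^S(\varepsilon_0^S),\quad U_t=f_t^U(\varepsilon_t^U),\quad A_t=f_t^A(S_t,U_t,\varepsilon_t^A),\quad S_{t+1}=f_{t+1}^S(S_t,A_t,U_t,\varepsilon_{t+1}^S),$$ with $S_t\in\mathcal S_t$, $A_t\in\mathcal A$. The value spaces of $U_t$ (latent) and of the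 noises are arbitrary and may depend on $M$. *Independent noise*: all the exogenous variables are mutually independent. The observational law $P_M$ is the law of $(S_0,A_0,\dots,A_{T-1},S_T)$. A regime is $d=(d_0,\dots,d_{T-1})$ with $d_t:\mathcal S_t\to\mathcal A$. *Modularity*: intervening by $d$ replaces the equation for $A_t$ by $A_t=d_t(S_t)$ for every $t$ and leaves all other equations unchanged; the interventional law $P^d_M$ is the law of the resulting trajectory. **Graph.** $G$ is a fixed acyclic directed mixed graph with directed edges $S_t\to A_t$, $S_t\to S_{t+1}$, $A_t\to S_{t+1}$ ($0\le t\le T-1$), $S_T\to Y$, and, for $t$ in some given subset of $\{0,\dots,T-1\}$, a bidirected edge $A_t\leftrightarrow S_{t+1}$; no other bidirected edges. $M$ is compatible with $G$ if, whenever $A_t\leftrightarrow S_{t+1}$ is absent, no latent variable affects both $A_t$ and $S_{t+1}$ at step $t$ (i.e. $U_t$ does not enter both the $A_t$- and the $S_{t+1}$-equation: at least one of $f_t^A,f_{t+1}^S$ does not depend on its $U_t$-argument). If the edge is present, a common cause is permitted but not required. **Structural successor sets.** $\mathbf S=(\mathcal S_{t+1}(s,a))$, $0\le t\le T-1$, $s\in\mathcal S_t$, $a\in\mathcal A$, is a fixed family of nonempty sets $\mathcal S_{t+1}(s,a)\subseteq\mathcal S_{t+1}$. $M$ respects $\mathbf S$ if $f_{t+1}^S(s,a,u,e)\in\mathcal S_{t+1}(s,a)$ for all $t,s,a$ and all admissible values $u,e$ of $U_t,\varepsilon_{t+1}^S$. **Admissible class and identified set.** Given a fixed observational law $P$,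 $\mathcal M(P,G,\mathbf S)$ is the collection of SCMs $M$ with structural equations $S_0=f_0^S(\varepsilon_0^S)$, $U_t=f_t^U(\varepsilon_t^U)$, $A_t=f_t^A(S_t,U_t,\varepsilon_t^A)$, $S_{t+1}=f_{t+1}^S(S_t,A_t,U_t,\varepsilon_{t+1}^S)$ ($0\le t\le T-1$), with independent noise, $P_M=P$, compatible with $G$, respecting $\mathbf S$. The causal identified set is $\mathcal I^d(P,G,\mathbf S)=\{P_M^d: M\in\mathcal M(P,G,\mathbf S)\}$. **Root convention.** $\mathcal S_{-1}=\{*\}$, $S_{-1}\equiv *$, $\mathcal A_{-1}=\{\star\}$, $d_{-1}( * )=\star$, $\mathcal S_0( *,\star)=\mathcal S_0$; $\mathcal A_t=\mathcal A$ for $t\ge0$. **Default family.** $\mathcal Q^{\mathrm{default}}=\{\mathcal Q_t^{\mathrm{default}}(s,a): t=-1,\dots,T-1,\ s\in\mathcal S_t,\ a\in\mathcal A_t\}$, where - $\mathcal Q_{-1}^{\mathrm{default}}( *,\star)=\{P(S_0\in\cdot)\}$; - if $t\ge0$ and $P(S_t=s,A_t=a)=0$: $\mathcal Q_t^{\mathrm{default}}(s,a)=\Delta(\mathcal S_{t+1}(s,a))$; - if $t\ge0$, $P(S_t=s,A_t=a)>0$ and $A_t\leftrightarrow S_{t+1}$ is absent from $G$: $\mathcal Q_t^{\mathrm{default}}(s,a)=\{P(S_{t+1}\in\cdot\mid S_t=s,A_t=a)\}$; - if $t\ge0$, $P(S_t=s,A_t=a)>0$ and $A_t\leftrightarrow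 S_{t+1}$ is present in $G$: $\mathcal Q_t^{\mathrm{default}}(s,a)=\{q\in\Delta(\mathcal S_{t+1}(s,a)): \underline\pi_t(s'\mid s,a)\le q(s')\le\bar\pi_t(s'\mid s,a)\ \forall s'\in\mathcal S_{t+1}(s,a)\}$, with $\underline\pi_t(s'\mid s,a)=P(S_{t+1}=s',A_t=a\mid S_t=s)$ and $\bar\pi_t(s'\mid s,a)=\underline\pi_t(s'\mid s,a)+P(A_t\ne a\mid S_t=s)$. **Ambiguity set.** For a family $\mathcal Q=\{\mathcal Q_t(s,a)\}$, $\mathcal P^d(\mathcal Q)$ is the set of all distributions $Q$ on trajectories of the form $$Q(\mathbf v)=q_{-1}(s_0\mid *,\star)\prod_{t=0}^{T-1}\mathbf 1\{a_t=d_t(s_t)\}\,q_t(s_{t+1}\mid s_t,a_t),$$ where $q_t(\cdot\mid s,d_t(s))\in\mathcal Q_t(s,d_t(s))$ for every $t=-1,\dots,T-1$ and $s\in\mathcal S_t$. *)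

(* Defs.v *)
From HB Require Import structures.
From mathcomp Require Export all_boot all_order all_algebra.
From mathcomp Require Export finmap.
From mathcomp Require Export all_classical all_reals all_analysis.

Set Implicit Arguments.
Unset Strict Implicit.
Unset Printing Implicit Defensive.

Import Order.TTheory GRing.Theory Num.Theory.

Local Open Scope classical_set_scope.
Local Open Scope ring_scope.

Section Distributions.
Variable R : realType.

Definition distr (X : finType) : set (X -> R) :=
  [set p | (forall x, 0 <= p x) /\ \sum_(x : X) p x = 1].

Definition distr_on (X : finType) (B : {set X}) : set (X -> R) :=
  [set p | distr p /\ forall x, x \notin B -> p x = 0].

Definition prob (X : finType) (P : X -> R) (E : pred X) : R :=
  \sum_(x : X | E x) P x.

Definition condprob (X : finType) (P : X -> R) (E F : pred X) : R :=
  prob P (predI E F) / prob P F.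

(* Mutual independence of a finite family of random elements. *)
Definition mutually_independent (d : measure_display) (W : measurableType d)
    (Q : probability W R) (I : finType) (dE : I -> measure_display)
    (E : forall i, measurableType (dE i)) (X : forall i, W -> E i) : Prop :=
  forall (J : {set I}) (B : forall i, set (E i)),
    (forall i, measurable (B i)) ->
    fine (Q (\bigcap_(i in [set` J]) (X i @^-1` B i))) =
    \prod_(i in J) fine (Q (X i @^-1` B i)).

End Distributions.

(* The state spaces are indexed by nat so that [S t.+1] needs no transport;
   only [S 0], ..., [S T] are ever used. *)
Section Model.
Variables (R : realType) (T : nat) (S : nat -> finType) (A : finType).

Definition regime := forall t : 'I_T, S t -> A.

Definition successors := forall t : 'I_T, S t -> A -> {set S t.+1}.

Definition trajectory : finType :=
  ({dffun forall t : 'I_T.+1, S t} * {ffun 'I_T -> A})%type.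

Definition init_state (v : trajectory) : S 0 := v.1 ord0.
Definition state_at (v : trajectory) (t : 'I_T) : S t :=
  v.1 (widen_ord (leqnSn T) t).
Definition next_state (v : trajectory) (t : 'I_T) : S t.+1 :=
  v.1 (@Ordinal T.+1 t.+1 (ltn_ord t)).
Definition action_at (v : trajectory) (t : 'I_T) : A := v.2 t.

(* Labels of the exogenous variables; [exoS t] labels the noise of the
   equation for the state at time [t.+1]. *)
Definition exo : finType := option ('I_T + 'I_T + 'I_T)%type.
Definition exoS0 : exo := None.
Definition exoU (t : 'I_T) : exo := Some (inl (inl t)).
Definition exoA (t : 'I_T) : exo := Some (inl (inr t)).
Definition exoS (t : 'I_T) : exo := Some (inr t).

(* The finite spaces carry the discrete sigma-algebra: a map into one of them
   is measurable when its fibres are, and measurability in a finite argument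
   is automatic. *)
Record scm := SCM {
  scm_disp : measure_display;
  Omega : measurableType scm_disp;
  scm_prob : probability Omega R;
  noise_disp : exo -> measure_display;
  noise : forall i, measurableType (noise_disp i);
  eps : forall i, Omega -> noise i;
  eps_measurable : forall i, measurable_fun [set: Omega] (eps i);
  latent_disp : 'I_T -> measure_display;
  latent : forall t, measurableType (latent_disp t);
  fS0 : noise exoS0 -> S 0;
  fU : forall t : 'I_T, noise (exoU t) -> latent t;
  fA : forall t : 'I_T, S t -> latent t -> noise (exoA t) -> A;
  fS : forall t : 'I_T, S t -> A -> latent t -> noise (exoS t) -> S t.+1;
  fS0_measurable : forall s, measurable [set e | fS0 e = s];
  fU_measurable : forall t, measurable_fun [set: noise (exoU t)] (@fU t);
  fA_measurable : forall (t : 'I_T) (s : S t) (a : A),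
    measurable [set x : latent t * noise (exoA t) | fA s x.1 x.2 = a];
  fS_measurable : forall (t : 'I_T) (s : S t) (a : A) (s' : S t.+1),
    measurable [set x : latent t * noise (exoS t) | fS s a x.1 x.2 = s']
}.

Section Solution.
Variables (M : scm) (w : Omega M).

Definition scm_latent (t : 'I_T) : latent M t := fU (eps (exoU t) w).

Fixpoint scm_state (n : nat) : (n <= T)%N -> S n :=
  match n with
  | 0 => fun _ => fS0 (eps exoS0 w)
  | m.+1 => fun lt_mT =>
      let t := Ordinal lt_mT in
      let s := scm_state (ltnW lt_mT) in
      let u := scm_latent t in
      let a := fA (t := t) s u (eps (exoA t) w) in
      fS (t := t) s a u (eps (exoS t) w)
  end.

Definition scm_action (t : 'I_T) : A :=
  fA (t := t) (scm_state (ltnW (ltn_ord t))) (scm_latent t) (eps (exoA t) w).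

Definition scm_trajectory : trajectory :=
  (finfun (fun t : 'I_T.+1 => scm_state (ltn_ord t : (t <= T)%N)),
   [ffun t => scm_action t]).

End Solution.

Definition law (M : scm) : trajectory -> R :=
  fun v => fine (scm_prob M [set w | scm_trajectory w = v]).

Lemma intervened_measurable (M : scm) (d : regime) (t : 'I_T) (s : S t)
    (a : A) :
  measurable [set x : latent M t * noise M (exoA t) | d t s = a].
Proof.
have [da|da] := pselect (d t s = a).
  rewrite (_ : [set _ | _] = setT); first exact: measurableT.
  by apply/seteqP; split.
rewrite (_ : [set _ | _] = set0); first exact: measurable0.
by apply/seteqP; split.
Qed.

(* Modularity: only the treatment equations are replaced. *)
Definition intervene (M : scm) (d : regime) : scm :=
  {| scm_prob := scm_prob M;
     eps := @eps M;
     eps_measurable := @eps_measurable M;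
     latent := @latent M;
     fS0 := @fS0 M;
     fU := @fU M;
     fA := fun t s _ _ => d t s;
     fS := @fS M;
     fS0_measurable := @fS0_measurable M;
     fU_measurable := @fU_measurable M;
     fA_measurable := @intervened_measurable M d;
     fS_measurable := @fS_measurable M |}.

Definition independent_noise (M : scm) : Prop :=
  mutually_independent (scm_prob M) (@eps M).

(* The directed edges of the graph are fixed, so the graph is encoded by the
   set [G] of the times [t] at which the bidirected edge between the treatment
   at [t] and the state at [t.+1] is present. *)
Definition compatible (G : {set 'I_T}) (M : scm) : Prop :=
  forall t : 'I_T, t \notin G ->
    (forall (s : S t) (u u' : latent M t) (e : noise M (exoA t)),
        fA s u e = fA s u' e) \/
    (forall (s : S t) (a : A) (u u' : latent M t) (e : noise M (exoS t)),
        fS s a u e = fS s a u' e).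

Definition respects (Succ : successors) (M : scm) : Prop :=
  forall (t : 'I_T) (s : S t) (a : A) (u : latent M t)
    (e : noise M (exoS t)), fS s a u e \in Succ t s a.

Definition admissible (P : trajectory -> R) (G : {set 'I_T})
    (Succ : successors) (M : scm) : Prop :=
  [/\ independent_noise M, law M = P, compatible G M & respects Succ M].

Definition identified_set (d : regime) (P : trajectory -> R) (G : {set 'I_T})
    (Succ : successors) : set (trajectory -> R) :=
  [set p | exists2 M : scm, admissible P G Succ M & p = law (intervene M d)].

(* [family_root] is the member of the family at t = -1, where the state and
   the treatment range over singletons. *)
Record transition_family := TransitionFamily {
  family_root : set (S 0 -> R);
  family_step : forall t : 'I_T, S t -> A -> set (S t.+1 -> R)
}.

Section Default.
Variables (P : trajectory -> R) (G : {set 'I_T}) (Succ : successors).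
Variables (t : 'I_T) (s : S t) (a : A).

Definition at_state : pred trajectory := fun v => state_at v t == s.
Definition at_action : pred trajectory := fun v => action_at v t == a.
Definition at_next (s' : S t.+1) : pred trajectory :=
  fun v => next_state v t == s'.

Definition pi_lower (s' : S t.+1) : R :=
  condprob P (predI (at_next s') at_action) at_state.

Definition pi_upper (s' : S t.+1) : R :=
  pi_lower s' + condprob P (predC at_action) at_state.

Definition default_step : set (S t.+1 -> R) :=
  if prob P (predI at_state at_action) == 0 then distr_on (Succ s a)
  else if t \in G then
    [set q | distr_on (Succ s a) q /\
       forall s', s' \in Succ s a -> pi_lower s' <= q s' <= pi_upper s']
  else [set (fun s' => condprob P (at_next s') (predI at_state at_action))].

End Default.

Definition default_family (P : trajectory -> R) (G : {set 'I_T})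
    (Succ : successors) : transition_family :=
  {| family_root := [set (fun s => prob P (fun v => init_state v == s))];
     family_step := @default_step P G Succ |}.

Definition ambiguity_set (d : regime) (F : transition_family) : set (trajectory -> R) :=
  [set p | distr p /\
     exists (q0 : S 0 -> R) (q : forall t : 'I_T, S t -> A -> S t.+1 -> R),
       [/\ family_root F q0,
           forall (t : 'I_T) (s : S t),
             family_step F s (d t s) (q t s (d t s)) &
           forall v, p v = q0 (init_state v) *
             \prod_(t < T) ((action_at v t == d t (state_at v t))%:R *
               q t (state_at v t) (action_at v t) (next_state v t))]].

End Model.

(* Main.v *)
(** By a pi-lambda argument the noises of distinct steps are independent as
    blocks, so the law of a model factors as the law of [S_0] times one-step
    kernels [K_t(a, s' | s)]; under a regime [d] the kernel becomes the law
    [q_t(s' | s)] of the response of [S_{t+1}] to the action [d_t(s)].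
    Monotonicity gives [K_t(a, s') <= q_t(s') <= K_t(a, s') + P(A_t <> a)] with
    [a = d_t(s)], and without a latent common cause [K_t] is a product, so [q_t]
    is the observed conditional law: each interventional law lies in the
    ambiguity set.

    Conversely, given [q_t >= K_t(d_t(s), .)] a latent variable draws, for every
    state [s], the natural action and successor from [K_t] and, independently, the
    successor under [d_t(s)] when this is not the natural action, from the
    normalised residual [q_t - K_t(d_t(s), .)].  The resulting model with finite
    noise has observed kernel [K_t] and interventional kernel [q_t].  As the
    construction is only constrained at states of positive probability, its
    observational law is first seen to agree with [P] on the support of [P];
    both being probabilities, they are equal. *)

From HB Require Import structures.
Require Import Defs.

Set Implicit Arguments.
Unset Strict Implicit.
Unset Printing Implicit Defensive.

Import Order.TTheory GRing.Theory Num.Theory.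

Local Open Scope classical_set_scope.
Local Open Scope ring_scope.

(** * Independence of blocks of random elements *)

Section Independence.
Variables (R : realType) (d : measure_display) (W : measurableType d).
Variable Q : probability W R.

(** Uniqueness of finite measures on a pi-system: intersecting with [B] and scaling by the mass of
    [B] give two measures that agree on [C], hence on the sigma-algebra it generates. *)
Lemma fineI_generated (C : set (set W)) (B : set W) :
  C `<=` measurable -> setI_closed C -> C setT -> measurable B ->
  (forall A, C A -> fine (Q (A `&` B)) = fine (Q A) * fine (Q B)) ->
  forall A, <<s C >> A -> fine (Q (A `&` B)) = fine (Q A) * fine (Q B).
Proof.
move=> Cm CI CT mB indC A sCA.
have ind' A' : C A' -> mrestr Q mB A' = mscale (NngNum (fine_ge0 (measure_ge0 Q B))) Q A'.
  move=> CA; have mA := Cm _ CA.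
  rewrite /mrestr /mscale /=.
  have /fineK <- : Q (A' `&` B) \is a fin_num.
    by apply: fin_num_measure; exact: measurableI.
  have /fineK <- : Q A' \is a fin_num by exact: fin_num_measure.
  by rewrite -EFinM indC // mulrC.
have mA : measurable A by exact: (smallest_sub (@sigma_algebra_measurable _ W) Cm).
(* Both measures are finite, so the constant sequence [setT] serves as the exhausting sequence. *)
have cT : \bigcup_(k : nat) (setT : set W) = setT by rewrite bigcup_const.
have : mrestr Q mB A = mscale (NngNum (fine_ge0 (measure_ge0 Q B))) Q A.
  apply: (@g_sigma_algebra_measure_unique _ _ _ C Cm (fun=> setT) (fun=> CT) cT
    (mrestr Q mB) (mscale (NngNum (fine_ge0 (measure_ge0 Q B))) Q) CI ind') => //.
  by move=> _; rewrite ltey_eq fin_num_measure.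
rewrite /mrestr /mscale /= => ->.
have /fineK <- : Q A \is a fin_num by exact: fin_num_measure.
by rewrite -EFinM /= mulrC.
Qed.

End Independence.

Section Blocks.
Variables (R : realType) (d : measure_display) (W : measurableType d).
Variables (Q : probability W R) (I : finType) (dE : I -> measure_display).
Variables (E : forall i, measurableType (dE i)) (X : forall i, W -> E i).
Hypothesis mX : forall i, measurable_fun setT (@X i).
Arguments X : clear implicits.

Definition cylinder (J : {set I}) : set (set W) :=
  [set A | exists2 B : forall i, set (E i), (forall i, measurable (B i)) &
     A = \bigcap_(i in [set` J]) (X i @^-1` B i)].

(** This is the sigma-algebra generated by the variables [X i] with [i] in [J]; the cylinders are a
    pi-system generating it. *)
Definition block (J : {set I}) : set (set W) := <<s cylinder J >>.

Lemma cylinder_measurable J : cylinder J `<=` measurable.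
Proof.
move=> _ [B mB ->]; apply: fin_bigcap_measurable => // i _.
by rewrite -[X in measurable X]setTI; exact: mX.
Qed.

Lemma cylinder_setI J : setI_closed (cylinder J).
Proof.
move=> _ _ [B mB ->] [C mC ->]; exists (fun i => B i `&` C i).
  by move=> i; exact: measurableI.
by rewrite -bigcapI.
Qed.

Lemma cylinder_setT J : cylinder J setT.
Proof.
exists (fun=> setT) => //; apply/esym/seteqP; split => // w _ i _.
Qed.

Lemma block_measurable J : block J `<=` measurable.
Proof.
by apply: smallest_sub; [exact: sigma_algebra_measurable|exact: cylinder_measurable].
Qed.

(** Mutual independence gives the product rule for two cylinders. It is extended one side at a time,
    first to [B] in the second block, then to [A] in the first. *)
Lemma block_independence (J1 J2 : {set I}) A B :
  mutually_independent Q X -> fintype.disjoint (mem J1) (mem J2) ->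
  block J1 A -> block J2 B ->
  fine (Q (A `&` B)) = fine (Q A) * fine (Q B).
Proof.
move=> indX J12 bA bB.
have ind_cyl A' B' : cylinder J1 A' -> cylinder J2 B' ->
    fine (Q (A' `&` B')) = fine (Q A') * fine (Q B').
  move=> [B1 m1 ->] [B2 m2 ->].
  (* One family for both cylinders: as [J1] and [J2] are disjoint, it restricts to [B1] on [J1] and
     to [B2] on [J2]. *)
  pose C i := if i \in J1 then B1 i else B2 i.
  have mC i : measurable (C i) by rewrite /C; case: ifP.
  have J2N i : i \in J2 -> (i \in J1) = false.
    by move=> iJ2; apply: (disjointFl J12).
  have E1 : \bigcap_(i in [set` J1]) (X i @^-1` B1 i) =
            \bigcap_(i in [set` J1]) (X i @^-1` C i).
    by apply: eq_bigcapr => i /= iJ; rewrite /C iJ.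
  have E2 : \bigcap_(i in [set` J2]) (X i @^-1` B2 i) =
            \bigcap_(i in [set` J2]) (X i @^-1` C i).
    by apply: eq_bigcapr => i /= iJ; rewrite /C J2N.
  rewrite E1 E2 -bigcap_setU.
  rewrite (_ : [set` J1] `|` [set` J2] = [set` J1 :|: J2]).
    by rewrite !indX // -bigU //=; apply: eq_bigl => i; rewrite !inE.
  by apply/seteqP; split => i /=; rewrite inE => /orP.
have ind_left A' : cylinder J1 A' -> fine (Q (A' `&` B)) = fine (Q A') * fine (Q B).
  move=> cA; rewrite setIC mulrC.
  apply: (fineI_generated (@cylinder_measurable J2)) => //.
  - exact: cylinder_setI.
  - exact: cylinder_setT.
  - exact: cylinder_measurable cA.
  - by move=> B' cB; rewrite setIC mulrC; exact: ind_cyl.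
apply: (fineI_generated (@cylinder_measurable J1)) => //.
- exact: cylinder_setI.
- exact: cylinder_setT.
- exact: block_measurable bB.
Qed.

Lemma block_measurable_fun (J : {set I}) i : i \in J ->
  measurable_fun setT (X i : g_sigma_algebraType (cylinder J) -> E i).
Proof.
move=> iJ _ B mB; rewrite setTI; apply: sub_sigma_algebra.
exists (dfwith (fun j => setT : set (E j)) i B).
  by move=> j; case: dfwithP => // *; exact: measurableT.
apply/seteqP; split => w /=.
  by move=> Bw j _; rewrite /preimage /=; case: dfwithP.
by move=> /(_ i iJ); rewrite /preimage /= dfwithin.
Qed.

End Blocks.

(** * Finite probability spaces *)

Lemma fine_partition (R : realType) (d : measure_display) (W : measurableType d)
    (Q : probability W R) (X : finType) (f : W -> X) (E : pred X) :
  (forall x, measurable [set w | f w = x]) ->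
  fine (Q [set w | E (f w)]) = \sum_(x | E x) fine (Q [set w | f w = x]).
Proof.
move=> mf.
rewrite (_ : [set w | E (f w)] = \bigcup_(x in [set` E]) [set w | f w = x]); last first.
  apply/seteqP; split=> w /=; first by move=> Ew; exists (f w).
  by move=> [x /= Ex ->].
rewrite measure_fin_bigcup //; last first.
- by move=> i j _ _ [w [/= fi fj]]; rewrite -fi -fj.
rewrite sum_fine; last by move=> x _; exact: fin_num_measure.
congr fine; apply/esym; apply: bigfs; first exact: index_enum_uniq.
by move=> x _; rewrite mem_index_enum.
Qed.

Lemma eq_sum_support (R : realType) (Z : finType) (p : Z -> R) (E F : pred Z) :
  (forall z, p z != 0 -> E z = F z) -> \sum_(z | E z) p z = \sum_(z | F z) p z.
Proof.
move=> EF; rewrite big_mkcond [RHS]big_mkcond; apply: eq_bigr => z _.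
have [->|/EF ->//] := eqVneq (p z) 0.
by rewrite !if_same.
Qed.

Lemma eq_prob (R : realType) (X : finType) (P : X -> R) (E F : pred X) :
  E =1 F -> prob P E = prob P F.
Proof. by move=> EF; apply: eq_bigl. Qed.

(** Off the support of [P] the difference [P' - P] is nonnegative, on it zero; having total zero, it
    vanishes everywhere. *)
Lemma eq_distr (R : realType) (X : finType) (P P' : X -> R) : distr P -> distr P' ->
  (forall x, P x != 0 -> P' x = P x) -> P' = P.
Proof.
move=> [P0 P1] [P'0 P'1] PP'; apply/funext => x.
have le0 y : 0 <= P' y - P y.
  have [->|/PP' ->] := eqVneq (P y) 0; first by rewrite subr0.
  by rewrite subrr.
apply/eqP; rewrite -subr_eq0; apply/eqP.
have sum0 : \sum_y (P' y - P y) = 0 by rewrite sumrB P1 P'1 subrr.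
by apply: (psumr_eq0P _ sum0) => // y _; exact: le0.
Qed.

Lemma sum_pair_mul (R : realType) (X Y : finType) (f : X -> R) (g : X -> Y -> R) :
  (forall x, \sum_y g x y = 1) ->
  \sum_(z : X * Y) f z.1 * g z.1 z.2 = \sum_x f x.
Proof.
move=> g1; rewrite -(pair_bigA _ (fun x y => f x * g x y)) /=.
by apply: eq_bigr => x _; rewrite -mulr_sumr g1 mulr1.
Qed.

Lemma distr_inhabited (R : realType) (X : finType) (p : X -> R) :
  distr p -> (0 < #|X|)%N.
Proof.
move=> [_ p1]; rewrite lt0n; apply/negP => /eqP X0.
move: p1; rewrite big_pred0 => [/eqP|x]; first by rewrite eq_sym oner_eq0.
by have := fintype0 x X0.
Qed.

Definition distr_point (R : realType) (X : finType) (p : X -> R)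
    (hp : distr p) : X :=
  projT1 (cid (elimT (card_gt0P) (distr_inhabited hp))).

(** The base point is a parameter of the alias so that the pointed structure can be inferred from
    the type alone. *)
Definition discrete (X : finType) (x0 : X) : Type := X.

HB.instance Definition _ (X : finType) (x0 : X) := Choice.copy (discrete x0) X.
HB.instance Definition _ (X : finType) (x0 : X) := isPointed.Build (discrete x0) x0.
HB.instance Definition _ (X : finType) (x0 : X) :=
  @isMeasurable.Build default_measure_display (discrete x0)
    discrete_measurable discrete_measurable0
    discrete_measurableC discrete_measurableU.

Section FiniteProbability.
Variables (R : realType) (X : finType) (x0 : X) (p : X -> R).
Hypothesis hp : distr p.

Let atom (k : nat) : {measure set (discrete x0) -> \bar R} :=
  mscale (NngNum (hp.1 (nth x0 (enum X) k))) (dirac (nth x0 (enum X) k : discrete x0)).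

Definition finite_prob : set (discrete x0) -> \bar R := msum atom #|X|.

HB.instance Definition _ := Measure.on finite_prob.

Lemma finite_probE (E : pred X) : finite_prob [set x | E x] = (\sum_(x | E x) p x)%:E.
Proof.
transitivity (\sum_(x in X) if E x then (p x)%:E else 0)%E; last first.
  by rewrite -sumEFin [RHS]big_mkcond.
rewrite big_enum_val; apply: eq_bigr => k _.
rewrite /atom /= -(enum_val_nth x0 k).
rewrite -[LHS]/((p (enum_val k))%:E * \d_(enum_val k : discrete x0) [set x | E x])%E
  diracE.
have [Ek|EkN] := boolP (E (enum_val k)); first by rewrite mem_set ?mule1.
by rewrite memNset ?mule0 //; exact/negP.
Qed.

Let finite_prob_setT : finite_prob setT = 1%E.
Proof.
rewrite (_ : setT = [set x | predT x]); last by apply/seteqP.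
by rewrite finite_probE hp.2.
Qed.

HB.instance Definition _ :=
  Measure_isProbability.Build _ _ _ finite_prob finite_prob_setT.

End FiniteProbability.

(** * Product measures on finite dependent products *)

Section FiniteProducts.
Variables (R : realType) (I : finType) (N : I -> finType).

Lemma sum_fprod (F : forall i, N i -> R) :
  \sum_(f : fprod N) \prod_i F i (f i) = \prod_i \sum_x F i x.
Proof.
pose G i : {ffun N i -> R} := [ffun x => F i x].
transitivity (\sum_(f : fprod N) \prod_(i in I) G i (f i)).
  by apply: eq_bigr => f _; apply: eq_bigr => i _; rewrite ffunE.
rewrite (@big_fprod R 0 1 *%R +%R I N G).
rewrite -(bigA_distr_big_dep (fun i => [pred j | j \in tagged_with N i])
  (fun i j => untag 0 (G i) j)).
apply: eq_bigr => i _.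
rewrite -[LHS](big_tag (fun i x => G i x) i).
by apply: eq_bigr => x _; rewrite ffunE.
Qed.

Variable w : forall i, N i -> R.
Arguments w : clear implicits.
Hypothesis hw : forall i, distr (w i).

Definition product_weight (f : fprod N) : R := \prod_i w i (f i).

Lemma sum_product_weight (B : forall i, pred (N i)) :
  \sum_(f : fprod N | [forall i, B i (f i)]) product_weight f =
  \prod_i \sum_(x | B i x) w i x.
Proof.
under [RHS]eq_bigr do rewrite big_mkcond.
rewrite -sum_fprod big_mkcond; apply: eq_bigr => f _.
case: ifPn => [/forallP fB|/forallPn [i fBi]].
  by apply: eq_bigr => i _; rewrite fB.
by rewrite (bigD1 i) //= (negbTE fBi) mul0r.
Qed.

Lemma product_weight_distr : distr product_weight.
Proof.
split=> [f|]; first by apply: prodr_ge0 => i _; exact: (hw i).1.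
rewrite sum_fprod big1 // => i _; exact: (hw i).2.
Qed.

Lemma sum_product_weight_coord (i : I) (B : pred (N i)) :
  \sum_(f : fprod N | B (f i)) product_weight f = \sum_(x | B x) w i x.
Proof.
(* The event is a rectangle that is trivial off coordinate [i], where the factors are total masses
   equal to one. *)
pose C := dfwith (fun j => predT : pred (N j)) i B.
rewrite (eq_bigl (fun f : fprod N => [forall j, C j (f j)])); last first.
  move=> f; apply/idP/forallP.
    by move=> Bf j; rewrite /C; case: dfwithP.
  by move=> /(_ i); rewrite /C dfwithin.
rewrite sum_product_weight (bigD1 i) //= /C dfwithin.
rewrite [X in _ * X]big1 ?mulr1 // => j ji.
by rewrite dfwithout 1?eq_sym // (hw j).2.
Qed.

End FiniteProducts.

(** Singletons are measurable rectangles and every set here is finite, so the product sigma-algebra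
    is discrete too. *)
Lemma measurable_discrete_prod (X Y : finType) (x0 : X) (y0 : Y)
    (B : set (discrete x0 * discrete y0)) : measurable B.
Proof.
apply: countable_measurable.
  move=> [x y]; rewrite (_ : [set (x, y)] = [set x] `*` [set y]).
    exact: measurableX.
  by apply/seteqP; split => [[u v] /= [-> ->]|[u v] /= [-> ->]].
apply: finite_set_countable; exact: (@finite_finset (X * Y)%type).
Qed.

(** * Coupling a natural action with its potential responses *)

Section Coupling.
Variables (R : realType) (A X : finType).

(** The excess of [q] over [K (a0, .)] has total mass [c], the mass of [K] on other actions, so
    dividing by [c] gives a distribution. *)
Lemma exists_residual (K : A * X -> R) (q : X -> R) (a0 : A) :
  distr K -> distr q -> (forall x, K (a0, x) <= q x) ->
  exists r : X -> R, [/\ distr r, forall x, q x = 0 -> r x = 0 &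
    forall x, K (a0, x) + (\sum_(z | z.1 != a0) K z) * r x = q x].
Proof.
move=> [K0 K1] [q0 q1] Kq; set c := \sum_(z | _) _.
have c0 : 0 <= c by apply: sumr_ge0.
have sumK : \sum_x K (a0, x) + c = 1.
  rewrite -K1 (bigID (fun z : A * X => z.1 == a0)) /=; congr (_ + _).
  rewrite [RHS](eq_big (fun z : A * X => (z.1 == a0) && predT z.2)
    (fun z => K (z.1, z.2))); last 2 first.
  - by move=> z; rewrite andbT.
  - by case.
  rewrite -(pair_big (pred1 a0) predT (fun a x => K (a, x))) /=.
  by rewrite big_pred1_eq.
have sumqK : \sum_x (q x - K (a0, x)) = c.
  by rewrite sumrB q1 -sumK addrAC subrr add0r.
have [c_eq0|c_neq0] := eqVneq c 0.
  (* With no residual mass [q] equals [K (a0, .)]; [r] is then multiplied by zero, and [q] itself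
     satisfies the support condition. *)
  exists q; split => // x; rewrite c_eq0 mul0r addr0; apply/eqP.
  rewrite eq_sym -subr_eq0; apply/eqP.
  apply: (psumr_eq0P _ (etrans sumqK c_eq0)) => // y _.
  by rewrite subr_ge0.
exists (fun x => (q x - K (a0, x)) / c); split.
- split=> [x|]; first by rewrite divr_ge0 // subr_ge0.
  by rewrite -mulr_suml sumqK divff.
- move=> x qx; suff -> : K (a0, x) = 0 by rewrite qx subr0 mul0r.
  by apply/eqP; rewrite eq_le K0 andbT -qx Kq.
- by move=> x; rewrite mulrC divfK // addrC subrK.
Qed.

Variable clip : A -> X -> X.

(* A point [z] carries a natural action [z.1.1], the state [z.1.2] it leads to,
   and the state [z.2] that any other action would lead to. *)
Definition natural_response (a : A) (z : A * X * X) : X :=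
  clip a (if a == z.1.1 then z.1.2 else z.2).

(** The coupling is the product of [K] and the residual [r]. The response to [a0] is the natural one
    if [a0] is the natural action and an [r]-draw otherwise, so its law is [K (a0, .) + c r = q].
    Since [clip] fixes the states charged by [K] and [q], it does not alter these laws. *)
Lemma exists_coupling (K : A * X -> R) (q : X -> R) (a0 : A) :
  distr K -> distr q -> (forall x, K (a0, x) <= q x) ->
  (forall a x, K (a, x) != 0 -> clip a x = x) ->
  (forall x, q x != 0 -> clip a0 x = x) ->
  exists p : A * X * X -> R, [/\ distr p,
    forall a x, \sum_(z | (z.1.1 == a) && (natural_response a z == x)) p z = K (a, x) &
    forall x, \sum_(z | natural_response a0 z == x) p z = q x].
Proof.
move=> dK dq Kq clipK clipq.
have [r [[r0 r1] rq Krq]] := exists_residual dK dq Kq.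
have [K0 K1] := dK.
have sumKr (g : A * X -> X -> R) : \sum_(z : A * X * X) g z.1 z.2 =
    \sum_y \sum_x g y x.
  by rewrite pair_bigA.
exists (fun z => K z.1 * r z.2); split.
- split=> [z|]; first by rewrite mulr_ge0.
  rewrite (sumKr (fun y x => K y * r x)).
  under eq_bigr do rewrite -mulr_sumr r1 mulr1.
  by [].
- move=> a x.
  rewrite (@eq_sum_support _ _ _ _ (fun z : A * X * X => (z.1 == (a, x)) && predT z.2)).
    rewrite -(pair_big (pred1 (a, x)) predT (fun y x => K y * r x)) /=.
    by rewrite big_pred1_eq -mulr_sumr r1 mulr1.
  move=> [[b y] y'] /=; rewrite mulf_eq0 negb_or => /andP[/clipK Kby _].
  rewrite /natural_response /= andbT xpair_eqE; have [<-|//] := eqVneq b a.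
  by rewrite Kby.
- move=> x.
  (* On the support [clip] disappears from both branches: from the first by [clipK], from the second
     because [r] vanishes wherever [q] does. *)
  rewrite (@eq_sum_support _ _ _ _ (fun z : A * X * X =>
    if a0 == z.1.1 then z.1.2 == x else z.2 == x)); last first.
    move=> [[b y] y'] /=; rewrite mulf_eq0 negb_or => /andP[/clipK Kby ry].
    rewrite /natural_response /=; have [ab|ab] := eqVneq a0 b; first by rewrite ab Kby.
    by rewrite clipq //; apply: contraNN ry => /eqP /rq ->.
  rewrite big_mkcond /= (sumKr (fun y x' =>
    if (if a0 == y.1 then y.2 == x else x' == x) then K y * r x' else 0)).
  rewrite -Krq (bigID (fun y : A * X => y.1 == a0)) /=; congr (_ + _).
    rewrite (bigD1 (a0, x)) //= !eqxx -mulr_sumr r1 mulr1 big1 ?addr0 //.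
    move=> [b y] /=; rewrite -pair_eqE /= => /andP[/eqP ->]; rewrite eqxx /=.
    by move=> /negbTE ->; rewrite big1.
  rewrite mulr_suml; apply: eq_bigr => y ya; rewrite eq_sym (negbTE ya).
  by rewrite -big_mkcond big_pred1_eq.
Qed.

End Coupling.

(** * The law of a structural causal model *)

Section ScmLaw.
Variables (R : realType) (T : nat) (S : nat -> finType) (A : finType).

Section Trajectories.
Variables (M : scm R T S A) (w : Omega M).

Lemma scm_stateS (t : 'I_T) (lt_tT : (t.+1 <= T)%N) (le_tT : (t <= T)%N) :
  scm_state w lt_tT =
  fS (scm_state w le_tT)
     (fA (scm_state w le_tT) (scm_latent w t) (eps (exoA t) w))
     (scm_latent w t) (eps (exoS t) w).
Proof.
case: t lt_tT le_tT => m lt_m lt_mT le_mT /=.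
by rewrite (bool_irrelevance lt_m lt_mT) (bool_irrelevance (ltnW lt_mT) le_mT).
Qed.

Lemma init_scm_trajectory : init_state (scm_trajectory w) = fS0 (eps (exoS0 T) w).
Proof. by rewrite /init_state ffunE. Qed.

Lemma action_scm_trajectory (t : 'I_T) :
  action_at (scm_trajectory w) t =
  fA (state_at (scm_trajectory w) t) (scm_latent w t) (eps (exoA t) w).
Proof.
rewrite /action_at /state_at !ffunE /scm_action; congr (fA _ _ _).
by congr scm_state; exact: bool_irrelevance.
Qed.

Lemma next_scm_trajectory (t : 'I_T) :
  next_state (scm_trajectory w) t =
  fS (state_at (scm_trajectory w) t) (action_at (scm_trajectory w) t)
     (scm_latent w t) (eps (exoS t) w).
Proof.
rewrite action_scm_trajectory /next_state /state_at !ffunE.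
exact: scm_stateS.
Qed.

(** The recursive equations have a unique solution, by induction on time. Substituting the states of
    [v] decouples the steps: each condition involves the noises of one step only. *)
Lemma scm_trajectory_eq (v : trajectory T S A) :
  scm_trajectory w = v <->
  fS0 (eps (exoS0 T) w) = init_state v /\
  forall t : 'I_T,
    fA (state_at v t) (scm_latent w t) (eps (exoA t) w) = action_at v t /\
    fS (state_at v t) (action_at v t) (scm_latent w t) (eps (exoS t) w)
      = next_state v t.
Proof.
split=> [<-|[v0 vS]].
  split=> [|t]; first by rewrite init_scm_trajectory.
  by rewrite -action_scm_trajectory -next_scm_trajectory.
have states n (lt_n : (n < T.+1)%N) :
    (scm_trajectory w).1 (Ordinal lt_n) = v.1 (Ordinal lt_n).
  elim: n lt_n => [|n IHn] lt_n.
    rewrite (bool_irrelevance lt_n (ltn0Sn T)).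
    by have := init_scm_trajectory; rewrite v0.
  have lt_nT : (n < T)%N := lt_n.
  have stE : state_at (scm_trajectory w) (Ordinal lt_nT) = state_at v (Ordinal lt_nT).
    exact: IHn.
  have := next_scm_trajectory (Ordinal lt_nT).
  rewrite action_scm_trajectory stE.
  have [-> ->] := vS (Ordinal lt_nT).
  by rewrite /next_state (bool_irrelevance lt_n (ltn_ord (Ordinal lt_nT))).
apply/eqP; rewrite -pair_eqE; apply/andP; split; apply/eqP; apply/ffunP => t.
  by case: t => n lt_n; exact: states.
rewrite -[LHS]/(action_at (scm_trajectory w) t) action_scm_trajectory.
have -> : state_at (scm_trajectory w) t = state_at v t by exact: states.
by have [-> _] := vS t.
Qed.

End Trajectories.

End ScmLaw.

(** * Factorisation of the law into one-step kernels *)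

Section Kernels.
Variables (R : realType) (T : nat) (S : nat -> finType) (A : finType).
Variable M : scm R T S A.

Definition pr (E : set (Omega M)) : R := fine (scm_prob M E).

Definition treatment_event (t : 'I_T) (s : S t) (a : A) : set (Omega M) :=
  [set w | fA s (scm_latent w t) (eps (exoA t) w) = a].

Definition response_event (t : 'I_T) (s : S t) (a : A) (s' : S t.+1) :
    set (Omega M) :=
  [set w | fS s a (scm_latent w t) (eps (exoS t) w) = s'].

Definition initial (s : S 0) : R := pr [set w | fS0 (eps (exoS0 T) w) = s].

Definition kernel (t : 'I_T) (s : S t) (a : A) (s' : S t.+1) : R :=
  pr (treatment_event s a `&` response_event s a s').

Definition state_event (n : nat) (le_nT : (n <= T)%N) (s : S n) :
    set (Omega M) :=
  [set w | scm_state w le_nT = s].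

(** These are the noises on which the state at time [n] depends: the initial one and those of the
    steps [t < n]. *)
Definition before (n : nat) : {set exo T} :=
  finset (fun i : option ('I_T + 'I_T + 'I_T) =>
    match i with
    | None => true
    | Some (inl (inl t)) | Some (inl (inr t)) | Some (inr t) => (t < n)%N
    end).

Definition at_step (t : 'I_T) : {set exo T} := [set exoU t; exoA t; exoS t]%SET.

Notation scm_block := (block (@eps _ _ _ _ M)).

Lemma block_bigcup (J : {set exo T}) (X : finType) (F : X -> set (Omega M)) :
  (forall x, scm_block J (F x)) -> scm_block J (\bigcup_x F x).
Proof.
move=> bF.
have := @fin_bigcup_measurable _
  (g_sigma_algebraType (cylinder (@eps _ _ _ _ M) J)) X setT F.
by apply => // x _; exact: bF.
Qed.

Lemma blockI (J : {set exo T}) (E F : set (Omega M)) :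
  scm_block J E -> scm_block J F -> scm_block J (E `&` F).
Proof.
exact: (@measurableI _ (g_sigma_algebraType (cylinder (@eps _ _ _ _ M) J))).
Qed.

(** Once [Omega] carries the block as its sigma-algebra, composition and pairing of measurable maps
    give the claim. *)
Lemma block_latent_noise (J : {set exo T}) (t : 'I_T) (i : exo T)
    (B : set (latent M t * noise M i)) :
  exoU t \in J -> i \in J -> measurable B ->
  scm_block J [set w | B (scm_latent w t, eps i w)].
Proof.
move=> UJ iJ mB.
pose GJ := g_sigma_algebraType (cylinder (@eps _ _ _ _ M) J).
have mU : measurable_fun setT (fun w : GJ => @scm_latent _ _ _ _ M w t).
  apply: measurableT_comp; first exact: fU_measurable.
  exact: block_measurable_fun.
have mi : measurable_fun setT (@eps _ _ _ _ M i : GJ -> _).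
  exact: block_measurable_fun.
have := measurable_fun_pair mU mi measurableT mB.
by rewrite setTI.
Qed.

Lemma block_noise (J : {set exo T}) (i : exo T) (B : set (noise M i)) :
  i \in J -> measurable B -> scm_block J [set w | B (eps i w)].
Proof.
move=> iJ mB.
have := @block_measurable_fun _ _ _ _ _ (@eps _ _ _ _ M) J i iJ measurableT _ mB.
by rewrite setTI.
Qed.

Lemma block_treatment (J : {set exo T}) (t : 'I_T) (s : S t) (a : A) :
  exoU t \in J -> exoA t \in J -> scm_block J (treatment_event s a).
Proof.
by move=> UJ AJ; exact: block_latent_noise UJ AJ (@fA_measurable _ _ _ _ M t s a).
Qed.

Lemma block_response (J : {set exo T}) (t : 'I_T) (s : S t) (a : A)
    (s' : S t.+1) :
  exoU t \in J -> exoS t \in J -> scm_block J (response_event s a s').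
Proof.
by move=> UJ SJ; exact: block_latent_noise UJ SJ (@fS_measurable _ _ _ _ M t s a s').
Qed.

Lemma block_step (t : 'I_T) (s : S t) (a : A) (s' : S t.+1) :
  scm_block (at_step t) (treatment_event s a `&` response_event s a s').
Proof.
by apply: blockI; [apply: block_treatment|apply: block_response];
  rewrite !inE eqxx ?orbT.
Qed.

Lemma mem_before (t : 'I_T) (n : nat) :
  ((exoU t \in before n) = (t < n)%N) * ((exoA t \in before n) = (t < n)%N) *
  ((exoS t \in before n) = (t < n)%N).
Proof. by rewrite !inE. Qed.

Lemma disjoint_before_at_step (t : 'I_T) :
  fintype.disjoint (mem (before t)) (mem (at_step t)).
Proof.
rewrite disjoint_subset; apply/fintype.subsetP => i bi.
rewrite !inE; apply/negP => /orP[/orP[]|] /eqP ii; move: bi;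
  by rewrite ii mem_before ltnn.
Qed.

Lemma block_state (J : {set exo T}) (n : nat) (le_nT : (n <= T)%N) (s : S n) :
  before n \subset J -> scm_block J (state_event le_nT s).
Proof.
elim: n le_nT s => [|n IHn] lt_nT s sJ.
  apply: (block_noise _ (@fS0_measurable _ _ _ _ M s)).
  by apply: (fintype.subsetP sJ); rewrite inE.
pose t := Ordinal lt_nT.
have IH r : scm_block J (state_event (ltnW lt_nT) r).
  apply: IHn; apply: fintype.subset_trans sJ; apply/fintype.subsetP => i.
  by rewrite !inE; case: i => [[[i|i]|i]|] //; exact: leqW.
have UJ : exoU t \in J by apply: (fintype.subsetP sJ); rewrite mem_before.
have AJ : exoA t \in J by apply: (fintype.subsetP sJ); rewrite mem_before.
have SJ : exoS t \in J by apply: (fintype.subsetP sJ); rewrite mem_before.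
(* Measurability of [fA] and [fS] is available at fixed states and actions, so the event is split
   over the finitely many previous state-action pairs. *)
rewrite (_ : state_event lt_nT s = \bigcup_(x : S t * A)
   (state_event (ltnW lt_nT) x.1 `&`
     (@treatment_event t x.1 x.2 `&` @response_event t x.1 x.2 s))).
  apply: block_bigcup => x; apply: blockI; first exact: IH.
  by apply: blockI; [exact: block_treatment|exact: block_response].
apply/seteqP; split => w; rewrite /state_event /=.
  move=> <-; exists (scm_state w (ltnW lt_nT),
    fA (t := t) (scm_state w (ltnW lt_nT)) (scm_latent w t) (eps (exoA t) w)) => //.
by move=> [[r a] _] [/= <- [<-]].
Qed.

Lemma block_scm_measurable (J : {set exo T}) E : scm_block J E -> measurable E.
Proof. by apply: block_measurable; exact: eps_measurable. Qed.

Hypothesis indM : independent_noise M.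

Lemma pr_before_step (t : 'I_T) E F :
  scm_block (before t) E -> scm_block (at_step t) F -> pr (E `&` F) = pr E * pr F.
Proof.
apply: block_independence => //; first exact: eps_measurable.
exact: disjoint_before_at_step.
Qed.

Definition prefix_event (v : trajectory T S A) (n : nat) : set (Omega M) :=
  [set w | fS0 (eps (exoS0 T) w) = init_state v /\
    forall t : 'I_T, (t < n)%N ->
      treatment_event (state_at v t) (action_at v t) w /\
      response_event (state_at v t) (action_at v t) (next_state v t) w].

Lemma prefix_eventS v (t : 'I_T) :
  prefix_event v t.+1 = prefix_event v t `&`
    (treatment_event (state_at v t) (action_at v t) `&`
     response_event (state_at v t) (action_at v t) (next_state v t)).
Proof.
apply/seteqP; split=> w.
  move=> [w0 wt]; split; last exact: wt.
  by split => // r lt_rt; apply: wt; exact: ltnW.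
move=> [[w0 wt] wE]; split => // r; rewrite ltnS leq_eqVlt => /orP[|/wt//].
by move=> /eqP /val_inj ->.
Qed.

Lemma block_prefix v (n : nat) : (n <= T)%N ->
  scm_block (before n) (prefix_event v n).
Proof.
have bS0 m : scm_block (before m) [set w | fS0 (eps (exoS0 T) w) = init_state v].
  by apply: (block_noise _ (@fS0_measurable _ _ _ _ M (init_state v))); rewrite inE.
(* The block stays fixed while the prefix grows, so all intersections are taken in one
   sigma-algebra. *)
move=> le_nT; suff bn m : (m <= n)%N -> scm_block (before n) (prefix_event v m).
  exact: bn.
elim: m => [|m IHm] lt_mn.
  rewrite (_ : prefix_event v 0 = [set w | fS0 (eps (exoS0 T) w) = init_state v]) //.
  by apply/seteqP; split => w => [[]//|].
rewrite (prefix_eventS v (Ordinal (leq_trans lt_mn le_nT))).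
apply: blockI; first by apply: IHm; exact: ltnW.
by apply: blockI; [apply: block_treatment|apply: block_response];
  rewrite mem_before.
Qed.

(** Lengthening the prefix by one step intersects it with an event of that step's noises,
    independent of the earlier ones, and so contributes one kernel factor. *)
Lemma lawE v : law M v = initial (init_state v) *
  \prod_(t < T) kernel (state_at v t) (action_at v t) (next_state v t).
Proof.
have -> : law M v = pr (prefix_event v T).
  rewrite /law; congr fine; congr (scm_prob M _).
  apply/seteqP; split=> w /=.
    by move=> /scm_trajectory_eq [w0 wt]; split => // t _; exact: wt.
  by move=> [w0 wt]; apply/scm_trajectory_eq; split => // t; exact: wt.
suff prE n : (n <= T)%N -> pr (prefix_event v n) = initial (init_state v) *
    \prod_(t < T | (t < n)%N) kernel (state_at v t) (action_at v t) (next_state v t).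
  by rewrite prE //; congr (_ * _); apply: eq_bigl => t; rewrite ltn_ord.
elim: n => [_|n IHn lt_nT].
  rewrite big_pred0 // mulr1; congr pr.
  by apply/seteqP; split => w => [[]//|].
rewrite (prefix_eventS v (Ordinal lt_nT))
  (pr_before_step (t := Ordinal lt_nT)); last 2 first.
- by apply: block_prefix; exact: ltnW.
- exact: block_step.
rewrite IHn; last exact: ltnW.
rewrite [in RHS](bigD1 (Ordinal lt_nT)) //= -mulrA; congr (_ * _).
rewrite mulrC; congr (_ * _).
apply: eq_bigl => t; rewrite ltnS -val_eqE /=.
by rewrite ltn_neqAle andbC.
Qed.

End Kernels.

(** * Marginals of the law and bounds on the response *)

Section KernelFacts.
Variables (R : realType) (T : nat) (S : nat -> finType) (A : finType).
Variable M : scm R T S A.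
Hypothesis indM : independent_noise M.

Lemma pr_ge0 (E : set (Omega M)) : 0 <= pr E.
Proof. exact/fine_ge0/measure_ge0. Qed.

Lemma pr_le (E F : set (Omega M)) :
  measurable E -> measurable F -> E `<=` F -> pr E <= pr F.
Proof.
by move=> mE mF EF; rewrite fine_le ?fin_num_measure // le_measure ?inE.
Qed.

Lemma pr_leU (E F G : set (Omega M)) :
  measurable E -> measurable F -> measurable G -> E `<=` F `|` G ->
  pr E <= pr F + pr G.
Proof.
move=> mE mF mG EFG.
rewrite -fineD ?fin_num_measure //.
rewrite fine_le ?fin_num_measure // ?fin_numD ?fin_num_measure //.
apply: (le_trans (y := scm_prob M (F `|` G))).
  by rewrite le_measure ?inE //; exact: measurableU.
exact: measureU2.
Qed.

Lemma measurable_treatment (t : 'I_T) (s : S t) (a : A) :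
  measurable (treatment_event s a : set (Omega M)).
Proof.
by apply: (block_scm_measurable (block_treatment (J := finset.setT) _ _ _ _));
  rewrite inE.
Qed.

Lemma measurable_response (t : 'I_T) (s : S t) (a : A) (s' : S t.+1) :
  measurable (response_event s a s' : set (Omega M)).
Proof.
by apply: (block_scm_measurable (block_response (J := finset.setT) _ _ _ _ _));
  rewrite inE.
Qed.

Lemma measurable_scm_trajectory v :
  measurable [set w : Omega M | scm_trajectory w = v].
Proof.
rewrite (_ : [set w | _] = prefix_event (M := M) v T).
  exact: (block_scm_measurable (block_prefix v (leqnn T))).
apply/seteqP; split=> w /=.
  by move=> /scm_trajectory_eq [w0 wt]; split => // t _; exact: wt.
by move=> [w0 wt]; apply/scm_trajectory_eq; split => // t; exact: wt.
Qed.

Lemma prob_law (E : pred (trajectory T S A)) :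
  prob (law M) E = pr [set w : Omega M | E (scm_trajectory w)].
Proof.
rewrite /pr (fine_partition (scm_prob M)) //.
exact: measurable_scm_trajectory.
Qed.

Lemma law_distr : distr (law M).
Proof.
split=> [v|]; first exact: pr_ge0.
rewrite -[LHS]/(prob (law M) predT) prob_law.
by rewrite (_ : [set w | _] = setT) ?/pr ?probability_setT //; apply/seteqP.
Qed.

Lemma prob_init s : prob (law M) (fun v => init_state v == s) = initial M s.
Proof.
rewrite prob_law; congr pr; apply/seteqP; split => w /=;
  by rewrite init_scm_trajectory => /eqP.
Qed.

Definition state_prob (t : 'I_T) (s : S t) : R :=
  pr (state_event (ltnW (ltn_ord t)) s : set (Omega M)).

Lemma state_at_scm_trajectory (w : Omega M) (t : 'I_T) :
  state_at (scm_trajectory w) t = scm_state w (ltnW (ltn_ord t)).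
Proof.
rewrite /state_at ffunE; congr scm_state; exact: bool_irrelevance.
Qed.

Lemma prob_state (t : 'I_T) (s : S t) : prob (law M) (at_state s) = state_prob s.
Proof.
rewrite prob_law; congr pr; apply/seteqP; split => w;
  by rewrite /at_state /state_event /= state_at_scm_trajectory => /eqP.
Qed.

(** The state is determined by earlier noises, hence independent of the current step; all the
    marginals below follow from this. *)
Lemma pr_state_step (t : 'I_T) (s : S t) (E : set (Omega M)) :
  block (@eps _ _ _ _ M) (at_step t) E ->
  pr (state_event (ltnW (ltn_ord t)) s `&` E) = state_prob s * pr E.
Proof. by move=> bE; apply: pr_before_step bE => //; exact: block_state. Qed.

Lemma block_step_treatment (t : 'I_T) (s : S t) a :
  block (@eps _ _ _ _ M) (at_step t) (treatment_event s a).
Proof. by apply: block_treatment; rewrite !inE eqxx ?orbT. Qed.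

Lemma prob_state_action (t : 'I_T) (s : S t) (a : A) :
  prob (law M) (predI (at_state s) (at_action t a)) =
  state_prob s * pr (treatment_event s a : set (Omega M)).
Proof.
rewrite -pr_state_step; last exact: block_step_treatment.
rewrite prob_law; congr pr; apply/seteqP; split => w;
  rewrite /at_state /at_action /state_event /treatment_event /=
    action_scm_trajectory state_at_scm_trajectory.
  by move=> /andP[/eqP -> /eqP].
by move=> [-> ->]; rewrite !eqxx.
Qed.

Lemma prob_state_not_action (t : 'I_T) (s : S t) (a : A) :
  prob (law M) (predI (predC (at_action t a)) (at_state s)) =
  state_prob s * pr (~` treatment_event s a : set (Omega M)).
Proof.
rewrite -pr_state_step; last first.
  by apply: sigma_algebraC; exact: block_step_treatment.
rewrite prob_law; congr pr; apply/seteqP; split => w;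
  rewrite /at_state /at_action /state_event /treatment_event /=
    action_scm_trajectory state_at_scm_trajectory.
  by move=> /andP[aN /eqP sE]; split => // aE; move: aN; rewrite sE aE eqxx.
by move=> [-> /eqP ->]; rewrite eqxx.
Qed.

Lemma prob_state_action_next (t : 'I_T) (s : S t) (a : A) (s' : S t.+1) :
  prob (law M) (predI (at_next s') (predI (at_state s) (at_action t a))) =
  state_prob s * kernel M s a s'.
Proof.
rewrite -pr_state_step; last exact: block_step.
rewrite prob_law; congr pr; apply/seteqP; split => w;
  rewrite /at_state /at_action /at_next /state_event /treatment_event
    /response_event /= next_scm_trajectory action_scm_trajectory
    state_at_scm_trajectory.
  by move=> /and3P[/eqP <- /eqP -> /eqP ->].
by move=> [-> [-> ->]]; rewrite !eqxx.
Qed.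

Lemma kernel_ge0 (t : 'I_T) (s : S t) (a : A) (s' : S t.+1) : 0 <= kernel M s a s'.
Proof. exact: pr_ge0. Qed.

Lemma kernel_le_response (t : 'I_T) (s : S t) (a : A) (s' : S t.+1) :
  kernel M s a s' <= pr (response_event s a s' : set (Omega M)).
Proof.
apply: pr_le => //.
- by apply: measurableI; [exact: measurable_treatment|exact: measurable_response].
- exact: measurable_response.
Qed.

(** The response to [a] is revealed when [a] is the natural action; otherwise nothing is known of
    it, and the whole event is charged. *)
Lemma response_le_kernel (t : 'I_T) (s : S t) (a : A) (s' : S t.+1) :
  pr (response_event s a s' : set (Omega M)) <=
  kernel M s a s' + pr (~` treatment_event s a : set (Omega M)).
Proof.
apply: pr_leU.
- exact: measurable_response.
- by apply: measurableI; [exact: measurable_treatment|exact: measurable_response].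
- by apply: measurableC; exact: measurable_treatment.
by move=> w wr; have [wt|wt] := pselect (treatment_event s a w); [left|right].
Qed.

Lemma sum_kernel (t : 'I_T) (s : S t) (a : A) :
  \sum_s' kernel M s a s' = pr (treatment_event s a : set (Omega M)).
Proof.
(* The natural action is paired with the response to the fixed action [a], so that summing over the
   second component leaves the treatment event. *)
pose f (w : Omega M) := (fA s (scm_latent w t) (eps (exoA t) w),
  fS s a (scm_latent w t) (eps (exoS t) w)) : A * S t.+1.
have fE x : [set w | f w = x] = treatment_event s x.1 `&` response_event s a x.2.
  by apply/seteqP; split=> w; case: x => b s'; [case|move=> [/= <- <-]].
rewrite (_ : treatment_event s a = [set w | (f w).1 == a]); last first.
  by apply/seteqP; split=> w /eqP.
rewrite /pr (fine_partition (scm_prob M) (f := f) (fun x => x.1 == a)); last first.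
  move=> x; rewrite fE.
  by apply: measurableI; [exact: measurable_treatment|exact: measurable_response].
under [RHS]eq_bigr => x _ do rewrite fE.
rewrite (eq_bigl (fun x : A * S t.+1 => (x.1 == a) && predT x.2)); last first.
  by move=> x; rewrite andbT.
rewrite -(pair_big (pred1 a) predT
  (fun b s' => fine (scm_prob M (treatment_event s b `&` response_event s a s')))) /=.
by rewrite big_pred1_eq.
Qed.

Lemma treatment_distr (t : 'I_T) (s : S t) :
  distr (fun a => pr (treatment_event s a : set (Omega M))).
Proof.
split=> [a|]; first exact: pr_ge0.
have := fine_partition (scm_prob M)
  (f := fun w => fA s (scm_latent w t) (eps (exoA t) w)) predT.
move=> <- //; last by move=> a; exact: measurable_treatment.
by rewrite (_ : [set w | _] = setT) ?probability_setT //; apply/seteqP.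
Qed.

Lemma initial_distr : distr (initial M).
Proof.
split=> [s|]; first exact: pr_ge0.
have := fine_partition (scm_prob M) (f := fun w => fS0 (eps (exoS0 T) w)) predT.
move=> <- //.
  by rewrite (_ : [set w | _] = setT) ?probability_setT //; apply/seteqP.
move=> s; apply: (block_scm_measurable (J := finset.setT)).
by apply: (block_noise _ (@fS0_measurable _ _ _ _ M s)); rewrite inE.
Qed.

Lemma response_distr (Succ : successors T S A) (t : 'I_T) (s : S t) (a : A) :
  respects Succ M ->
  distr_on (Succ t s a) (fun s' => pr (response_event s a s' : set (Omega M))).
Proof.
move=> resp; split; first split=> [s'|]; first exact: pr_ge0.
  have := fine_partition (scm_prob M)
    (f := fun w => fS s a (scm_latent w t) (eps (exoS t) w)) predT.
  move=> <- //; last by move=> s'; exact: measurable_response.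
  by rewrite (_ : [set w | _] = setT) ?probability_setT //; apply/seteqP.
move=> s' s'N; rewrite /pr (_ : response_event s a s' = set0) ?measure0 //.
apply/seteqP; split => // w; rewrite /response_event /= => wE.
by move: s'N; rewrite -wE resp.
Qed.

(* A map that ignores the latent variable gives an event of a single noise, so
   the two events lie in disjoint blocks. *)
Lemma unconfounded_kernel (G : {set 'I_T}) (t : 'I_T) (s : S t) (a : A) (s' : S t.+1) :
  compatible G M -> t \notin G ->
  kernel M s a s' = pr (treatment_event s a : set (Omega M)) *
                    pr (response_event s a s' : set (Omega M)).
Proof.
(* An arbitrary latent value, substituted in whichever equation ignores the latent; measurability
   then comes from the section at [u0]. *)
move=> compat tG; pose u0 : latent M t := scm_latent point t.
have [noU|noU] := compat t tG.
  apply: (block_independence (@eps_measurable _ _ _ _ M) (J1 := [set exoA t]%SET)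
    (J2 := [set exoU t; exoS t]%SET)) => //.
  - by rewrite disjoints1 !inE.
  - rewrite (_ : treatment_event s a =
        [set w | [set e | fA s u0 e = a] (eps (exoA t) w)]).
      apply: block_noise; first by rewrite inE.
      have := measurable_xsection u0 (@fA_measurable _ _ _ _ M t s a).
      by rewrite xsectionE.
    by apply/seteqP; split => w; rewrite /treatment_event /= (noU _ _ u0).
  - by apply: block_response; rewrite !inE eqxx ?orbT.
apply: (block_independence (@eps_measurable _ _ _ _ M) (J2 := [set exoS t]%SET)
    (J1 := [set exoU t; exoA t]%SET)) => //.
- by rewrite disjoint_sym disjoints1 !inE.
- by apply: block_treatment; rewrite !inE eqxx ?orbT.
rewrite (_ : response_event s a s' =
    [set w | [set e | fS s a u0 e = s'] (eps (exoS t) w)]).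
  apply: block_noise; first by rewrite inE.
  have := measurable_xsection u0 (@fS_measurable _ _ _ _ M t s a s').
  by rewrite xsectionE.
by apply/seteqP; split => w; rewrite /response_event /= (noU _ _ _ u0).
Qed.

(** The intervened model keeps the noises, so the factorisation applies to it; its treatment events
    are the whole space or empty, which yields the indicator. *)
Lemma law_interveneE (d : regime T S A) v :
  law (intervene M d) v = initial M (init_state v) *
  \prod_(t < T) ((action_at v t == d t (state_at v t))%:R *
    pr (response_event (state_at v t) (action_at v t) (next_state v t) : set (Omega M))).
Proof.
rewrite (lawE (M := intervene M d)) //; congr (_ * _); apply: eq_bigr => t _.
rewrite /kernel; have [aE|aN] := eqVneq.
  rewrite mul1r (_ : _ `&` _ =
    response_event (M := intervene M d) (state_at v t) (action_at v t)
      (next_state v t)) //.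
  by apply/seteqP; split => [w []//|w wr]; split => //; rewrite /treatment_event /= aE.
rewrite mul0r (_ : _ `&` _ = set0) ?/pr ?measure0 //.
apply/seteqP; split => // w [wt _]; move: wt; rewrite /treatment_event /= => dE.
by rewrite dE eqxx in aN.
Qed.

End KernelFacts.

(** * Models with finite noise *)

Section FiniteScm.
Variables (R : realType) (T : nat) (S : nat -> finType) (A : finType).
Variables (N : exo T -> finType) (p : forall i, N i -> R).
Arguments p : clear implicits.
Hypothesis hp : forall i, distr (p i).
Variable f0 : N (exoS0 T) -> S 0.
Variable fa : forall t : 'I_T, S t -> N (exoU t) -> N (exoA t) -> A.
Variable fs : forall t : 'I_T, S t -> A -> N (exoU t) -> N (exoS t) -> S t.+1.

Let noise_pt i : N i := distr_point (hp i).
Let omega_pt : fprod N := distr_point (product_weight_distr hp).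

(** This is the canonical model: [Omega] is the product of the noise spaces, each noise is a
    coordinate, and each latent is its own noise. *)
Definition finite_scm : scm R T S A :=
  @SCM R T S A _ (discrete omega_pt)
    (@finite_prob R _ omega_pt _ (product_weight_distr hp))
    (fun=> default_measure_display) (fun i => discrete (noise_pt i))
    (fun i (f : fprod N) => f i) (fun i _ B _ => Logic.I)
    (fun=> default_measure_display) (fun t => discrete (noise_pt (exoU t)))
    f0 (fun t => id) fa fs
    (fun s => Logic.I) (fun t _ B _ => Logic.I)
    (fun t s a => measurable_discrete_prod _)
    (fun t s a s' => measurable_discrete_prod _).

Lemma pr_finite_scm (E : pred (fprod N)) :
  pr (M := finite_scm) [set f | E f] = \sum_(f | E f) product_weight p f.
Proof. by rewrite /pr /= finite_probE. Qed.

Lemma pr_noise (i : exo T) (B : pred (N i)) :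
  pr (M := finite_scm) [set f : Omega finite_scm | B (eps i f)] = \sum_(x | B x) p i x.
Proof.
by rewrite (pr_finite_scm (fun f => B (f i))) (sum_product_weight_coord hp).
Qed.

Lemma finite_scm_independent : independent_noise finite_scm.
Proof.
move=> J B mB.
have prB i : fine (scm_prob finite_scm (@eps _ _ _ _ finite_scm i @^-1` B i)) =
    \sum_(x | `[< B i x >]) p i x.
  rewrite -(pr_noise (fun x => `[< B i x >])) /pr; congr fine; congr (scm_prob _ _).
  by apply/seteqP; split => f /asboolP.
under eq_bigr do rewrite prB.
(* The event becomes a rectangle over all indices, with trivial constraints, hence factors equal to
   one, outside [J]. *)
rewrite [LHS](_ : _ = pr (M := finite_scm)
   [set f : Omega finite_scm |
      [forall i, (i \in J) ==> `[< B i (eps i f) >]] ]); last first.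
  congr fine; congr (scm_prob _ _); apply/seteqP; split => f /=.
    by move=> fB; apply/forallP => i; apply/implyP => iJ; apply/asboolP; exact: fB.
  by move=> /forallP fB i iJ; apply/asboolP; exact: implyP (fB i) iJ.
rewrite (pr_finite_scm (fun f : fprod N => [forall i, (i \in J) ==> `[< B i (f i) >]])).
rewrite (sum_product_weight p (fun i x => (i \in J) ==> `[< B i x >])).
rewrite [RHS]big_mkcond; apply: eq_bigr => i _ /=.
by case: ifPn => // _; exact: (hp i).2.
Qed.

Lemma pr_noise2 (i j : exo T) (B : pred (N i)) (C : pred (N j)) : i != j ->
  pr (M := finite_scm) ([set f : Omega finite_scm | B (eps i f)] `&`
    [set f : Omega finite_scm | C (eps j f)]) =
  (\sum_(x | B x) p i x) * (\sum_(x | C x) p j x).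
Proof.
move=> ij; rewrite -!pr_noise.
apply: (block_independence (@eps_measurable _ _ _ _ finite_scm)
   (J1 := [set i]%SET) (J2 := [set j]%SET)).
- exact: finite_scm_independent.
- by rewrite disjoints1 inE.
- by apply: (@block_noise _ _ _ _ finite_scm _ i [set x | B x]) => //; rewrite inE.
- by apply: (@block_noise _ _ _ _ finite_scm _ j [set x | C x]) => //; rewrite inE.
Qed.

End FiniteScm.

(** * A model with prescribed observed and interventional kernels *)

Section Construction.
Variables (R : realType) (T : nat) (S : nat -> finType) (A : finType).
Variables (G : {set 'I_T}) (Succ : successors T S A) (d : regime T S A).
Arguments Succ : clear implicits.
Hypothesis hSucc : forall (t : 'I_T) (s : S t) (a : A), (0 < #|Succ t s a|)%N.
(** [K] and [q] are the observed and interventional kernels to be realised. Where the bidirected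
    edge is absent, [al] and [kq] factor [K] into a treatment law and a response law. *)
Variables (q0 : S 0 -> R) (K : forall t : 'I_T, S t -> A * S t.+1 -> R)
  (q : forall t : 'I_T, S t -> S t.+1 -> R) (al : forall t : 'I_T, S t -> A -> R)
  (kq : forall t : 'I_T, S t -> A -> S t.+1 -> R).
Arguments K : clear implicits.
Arguments q : clear implicits.
Arguments al : clear implicits.
Arguments kq : clear implicits.
Hypotheses (hq0 : distr q0) (hK : forall t s, distr (K t s))
  (KSucc : forall t s a s', s' \notin Succ t s a -> K t s (a, s') = 0)
  (hq : forall t s, distr_on (Succ t s (d s)) (q t s))
  (Kq : forall t s s', K t s (d s, s') <= q t s s')
  (hal : forall t s, distr (al t s))
  (hkq : forall t s a, distr_on (Succ t s a) (kq t s a))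
  (Kalkq : forall t s a s', t \notin G -> K t s (a, s') = al t s a * kq t s a s')
  (kqq : forall t s s', t \notin G -> kq t s (d s) s' = q t s s').

Definition succ_point (t : 'I_T) (s : S t) (a : A) : S t.+1 :=
  projT1 (cid (elimT (card_gt0P) (hSucc s a))).

(** Respecting the successor sets is required at every noise value, null ones included, so stray
    values are redirected into the set. *)
Definition clip (t : 'I_T) (s : S t) (a : A) (s' : S t.+1) : S t.+1 :=
  if s' \in Succ t s a then s' else succ_point s a.

Lemma clip_in t s a s' : @clip t s a s' \in Succ t s a.
Proof.
by rewrite /clip; case: ifP => // _; rewrite /succ_point; case: cid.
Qed.

Lemma clipK t s a s' : s' \in Succ t s a -> clip s a s' = s'.
Proof. by rewrite /clip => ->. Qed.

Lemma coupling_exists (t : 'I_T) (s : S t) :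
  exists p : A * S t.+1 * S t.+1 -> R, [/\ distr p,
    forall a x, \sum_(z | (z.1.1 == a) && (natural_response (clip s) a z == x)) p z
      = K t s (a, x) &
    forall x, \sum_(z | natural_response (clip s) (d s) z == x) p z = q t s x].
Proof.
apply: exists_coupling => //; first exact: (hq s).1.
- move=> a x; apply: contraNeq => xN; rewrite KSucc //.
  by apply: contra_neqN xN => /clipK.
- move=> x; apply: contraNeq => xN; rewrite (hq s).2 //.
  by apply: contra_neqN xN => /clipK.
Qed.

Definition coupling (t : 'I_T) (s : S t) : A * S t.+1 * S t.+1 -> R :=
  projT1 (cid (coupling_exists s)).

Lemma couplingP (t : 'I_T) (s : S t) : [/\ distr (coupling s),
  forall a x, \sum_(z | (z.1.1 == a) && (natural_response (clip s) a z == x))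
     coupling s z = K t s (a, x) &
  forall x, \sum_(z | natural_response (clip s) (d s) z == x) coupling s z = q t s x].
Proof. by rewrite /coupling; case: cid. Qed.

(** Noises cannot depend on the state, so each is a table of draws, one per state or state-action
    pair, from which the equations read the relevant entry. *)
Definition noise_space (i : exo T) : finType :=
  match i : option ('I_T + 'I_T + 'I_T) with
  | None => S 0
  | Some (inl (inl t)) => fprod (fun _ : S t => (A * S t.+1 * S t.+1)%type)
  | Some (inl (inr t)) => fprod (fun _ : S t => A)
  | Some (inr t) => fprod (fun _ : S t * A => S t.+1)
  end.

Definition noise_weight (i : exo T) : noise_space i -> R :=
  match i as j return noise_space j -> R with
  | None => q0
  | Some (inl (inl t)) => product_weight (fun s : S t => coupling s)
  | Some (inl (inr t)) => product_weight (fun s : S t => al t s)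
  | Some (inr t) => product_weight (fun sa : S t * A => kq t sa.1 sa.2)
  end.

Lemma noise_weight_distr i : distr (@noise_weight i).
Proof.
case: i => [[[t|t]|t]|] //=; apply: product_weight_distr => //.
  by move=> s; have [] := couplingP s.
by move=> [s a]; exact: (hkq s a).1.
Qed.

Definition built_scm : scm R T S A :=
  finite_scm noise_weight_distr (fun e : noise_space (exoS0 T) => e)
   (fun t s (u : noise_space (exoU t)) (e : noise_space (exoA t)) =>
      if t \in G then (u s).1.1 else e s)
   (fun t s a (u : noise_space (exoU t)) (e : noise_space (exoS t)) =>
      if t \in G then natural_response (clip s) a (u s) else clip s a (e (s, a))).

Lemma built_independent : independent_noise built_scm.
Proof. exact: finite_scm_independent. Qed.

Lemma built_compatible : compatible G built_scm.
Proof. by move=> t tG; right => s a u u' e /=; rewrite (negbTE tG). Qed.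

Lemma built_respects : respects Succ built_scm.
Proof. by move=> t s a u e /=; case: ifP => _; exact: clip_in. Qed.

Lemma built_clip (t : 'I_T) (s : S t) (a : A) (s' : S t.+1) :
  \sum_(e : noise_space (exoS t) | clip s a (e (s, a)) == s') noise_weight e =
  kq t s a s'.
Proof.
rewrite /= (sum_product_weight_coord (w := fun sa : S t * A => kq t sa.1 sa.2) _
  (fun x => clip s a x == s') (i := (s, a))) /=; last first.
  by move=> [r b]; exact: (hkq r b).1.
rewrite (@eq_sum_support _ _ _ _ (pred1 s')) ?big_pred1_eq // => x.
case: (boolP (x \in Succ t s a)) => [/clipK -> //|xN].
by rewrite (hkq s a).2 // eqxx.
Qed.

Lemma pr_built_noise (i : exo T) (B : pred (noise_space i)) (E : set (Omega built_scm)) :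
  E = [set w : Omega built_scm | B (eps i w)] ->
  pr E = \sum_(x | B x) @noise_weight i x.
Proof. by move=> ->; exact: pr_noise. Qed.

Lemma built_initial s : initial built_scm s = q0 s.
Proof.
rewrite /initial (@pr_built_noise (exoS0 T) (pred1 s)); first by rewrite big_pred1_eq.
by apply/seteqP; split => w /= /eqP.
Qed.

(** With the edge present, both events read the entry [s] of one latent table, distributed as the
    coupling. With it absent, they read independent noises and the kernel is the product of [al] and
    [kq]. *)
Lemma built_kernel (t : 'I_T) (s : S t) (a : A) (s' : S t.+1) :
  kernel built_scm s a s' = K t s (a, s').
Proof.
have [tG|tG] := boolP (t \in G).
  have [dc <- _] := couplingP s.
  rewrite /kernel (@pr_built_noise (exoU t) (fun u =>
    ((u s).1.1 == a) && (natural_response (clip s) a (u s) == s'))).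
    rewrite /= -(sum_product_weight_coord (w := fun s : S t => coupling s)) //.
    by move=> r; have [] := couplingP r.
  apply/seteqP; split=> w; rewrite /treatment_event /response_event /= tG.
    by move=> [-> ->]; rewrite !eqxx.
  by move=> /andP[/eqP -> /eqP ->].
rewrite Kalkq // /kernel.
pose B (e : noise_space (exoA t)) := e s == a.
pose C (e : noise_space (exoS t)) := clip s a (e (s, a)) == s'.
have -> : treatment_event s a = [set w : Omega built_scm | B (eps (exoA t) w)].
  by apply/seteqP; split=> w; rewrite /treatment_event /B /= (negbTE tG) => /eqP.
have -> : response_event s a s' = [set w : Omega built_scm | C (eps (exoS t) w)].
  by apply/seteqP; split=> w; rewrite /response_event /C /= (negbTE tG) => /eqP.
rewrite (pr_noise2 noise_weight_distr _ _ _ B C) //; congr (_ * _).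
  rewrite /= (sum_product_weight_coord (w := fun s : S t => al t s) _ (pred1 a)) //.
  by rewrite big_pred1_eq.
exact: built_clip.
Qed.

Lemma built_response (t : 'I_T) (s : S t) (s' : S t.+1) :
  pr (response_event s (d s) s' : set (Omega built_scm)) = q t s s'.
Proof.
have [tG|tG] := boolP (t \in G).
  have [dc _ <-] := couplingP s.
  rewrite (@pr_built_noise (exoU t) (fun u =>
    natural_response (clip s) (d s) (u s) == s')).
    rewrite /= -(sum_product_weight_coord (w := fun s : S t => coupling s)) //.
    by move=> r; have [] := couplingP r.
  by apply/seteqP; split=> w; rewrite /response_event /= tG => /eqP.
rewrite -kqq // -built_clip; apply: (@pr_built_noise (exoS t)).
by apply/seteqP; split=> w; rewrite /response_event /= (negbTE tG) => /eqP.
Qed.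

Lemma exists_scm : exists M : scm R T S A,
  [/\ independent_noise M, compatible G M, respects Succ M, initial M =1 q0 &
    (forall (t : 'I_T) (s : S t) a s', kernel M s a s' = K t s (a, s')) /\
    (forall (t : 'I_T) (s : S t) s',
       pr (response_event s (d s) s' : set (Omega M)) = q t s s')].
Proof.
exists built_scm; split; [exact: built_independent|exact: built_compatible|
  exact: built_respects|exact: built_initial|].
by split; [exact: built_kernel|exact: built_response].
Qed.

End Construction.

(** * The default family *)

Section DefaultFamily.
Variables (R : realType) (T : nat) (S : nat -> finType) (A : finType).
Variables (G : {set 'I_T}) (Succ : successors T S A) (M : scm R T S A).
Arguments Succ : clear implicits.
Hypotheses (indM : independent_noise M) (compM : compatible G M)
  (respM : respects Succ M).

(** The state is independent of the step's noises, so its probability cancels in the conditional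
    one. *)
Lemma pi_lower_law (t : 'I_T) (s : S t) (a : A) (s' : S t.+1) :
  state_prob M s != 0 -> pi_lower (law M) s a s' = kernel M s a s'.
Proof.
move=> s_neq0; rewrite /pi_lower /condprob prob_state.
rewrite (@eq_prob _ _ _ _ (predI (at_next s') (predI (at_state s) (at_action t a)))).
  by rewrite prob_state_action_next // mulrC mulKf.
by move=> v; rewrite /= -andbA; congr (_ && _); exact: andbC.
Qed.

Lemma pi_upper_law (t : 'I_T) (s : S t) (a : A) (s' : S t.+1) :
  state_prob M s != 0 -> pi_upper (law M) s a s' =
  kernel M s a s' + pr (~` treatment_event s a : set (Omega M)).
Proof.
move=> s_neq0; rewrite /pi_upper pi_lower_law // /condprob prob_state.
by rewrite prob_state_not_action // [X in _ + X]mulrC mulKf.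
Qed.

Lemma state_prob_neq0 (t : 'I_T) (s : S t) (a : A) :
  prob (law M) (predI (at_state s) (at_action t a)) != 0 -> state_prob M s != 0.
Proof. by apply: contra_neq => s0; rewrite prob_state_action // s0 mul0r. Qed.

Lemma condprob_unconfounded (t : 'I_T) (s : S t) (a : A) (s' : S t.+1) :
  t \notin G -> prob (law M) (predI (at_state s) (at_action t a)) != 0 ->
  condprob (law M) (at_next s') (predI (at_state s) (at_action t a)) =
  pr (response_event s a s' : set (Omega M)).
Proof.
move=> tG sa0; rewrite /condprob prob_state_action_next //.
rewrite (unconfounded_kernel indM _ _ _ compM tG) // mulrA -prob_state_action //.
by rewrite mulrC mulKf.
Qed.

Lemma response_default (t : 'I_T) (s : S t) (a : A) :
  default_step (law M) G Succ s a
    (fun s' => pr (response_event s a s' : set (Omega M))).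
Proof.
rewrite /default_step; case: ifPn => [_|sa0]; first exact: response_distr.
have s0 := state_prob_neq0 sa0.
case: ifPn => tG; last first.
  by apply/funext => s'; rewrite condprob_unconfounded.
split=> [|s' _]; first exact: response_distr.
by rewrite pi_lower_law // pi_upper_law // kernel_le_response response_le_kernel.
Qed.

(** Without the edge, the observed conditional law is the response law of [M], which lives on the
    successor set because [M] respects it. *)
Lemma default_distr (t : 'I_T) (s : S t) (a : A) (q : S t.+1 -> R) :
  default_step (law M) G Succ s a q -> distr_on (Succ t s a) q.
Proof.
rewrite /default_step; case: ifPn => [_//|sa0]; case: ifPn => tG; first by case.
move=> ->; rewrite (_ : (fun s' => _) =
    fun s' => pr (response_event s a s' : set (Omega M))); first exact: response_distr.
by apply/funext => s'; rewrite condprob_unconfounded.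
Qed.

(** The default bound covers successors of observed pairs. Elsewhere the kernel of [M] vanishes:
    outside the successor set the response never occurs, and at a null pair with a non-null state
    the action has probability zero. *)
Lemma default_kernel_le (t : 'I_T) (s : S t) (a : A) (q : S t.+1 -> R) s' :
  t \in G -> state_prob M s != 0 -> default_step (law M) G Succ s a q ->
  kernel M s a s' <= q s'.
Proof.
move=> tG s0 dq; have [[q_ge0 _] _] := default_distr dq.
have [s'S|s'N] := boolP (s' \in Succ t s a); last first.
  apply: le_trans (kernel_le_response M s a s') _.
  by rewrite (response_distr s a respM).2.
move: dq; rewrite /default_step; case: ifPn => [/eqP sa0 _|sa0].
  have : pr (treatment_event s a : set (Omega M)) = 0.
    move/eqP: sa0; rewrite prob_state_action // mulf_eq0 (negbTE s0) /=.
    by move/eqP.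
  rewrite -sum_kernel => /eqP; rewrite psumr_eq0; last by move=> *; exact: kernel_ge0.
  by move=> /allP /(_ s' (mem_index_enum _)) /eqP ->.
rewrite tG => -[_ /(_ _ s'S) /andP[]].
by rewrite pi_lower_law.
Qed.

Lemma default_kernel_unconfounded (t : 'I_T) (s : S t) (a : A)
    (q : S t.+1 -> R) s' :
  t \notin G -> state_prob M s != 0 -> default_step (law M) G Succ s a q ->
  kernel M s a s' = pr (treatment_event s a : set (Omega M)) * q s'.
Proof.
move=> tG s0; rewrite (unconfounded_kernel indM _ _ _ compM tG) // /default_step.
case: ifPn => [/eqP sa0 _|sa0].
  move/eqP: sa0; rewrite prob_state_action // mulf_eq0 (negbTE s0) /= => /eqP ->.
  by rewrite !mul0r.
by rewrite (negbTE tG) => ->; rewrite condprob_unconfounded.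
Qed.

Lemma identified_in_ambiguity (d : regime T S A) :
  ambiguity_set d (default_family (law M) G Succ) (law (intervene M d)).
Proof.
split; first exact: law_distr.
exists (initial M), (fun t s a s' => pr (response_event s a s' : set (Omega M))); split.
- by apply/funext => s; rewrite -prob_init.
- by move=> t s; exact: response_default.
- exact: law_interveneE.
Qed.

Hypothesis hSucc : forall (t : 'I_T) (s : S t) (a : A), (0 < #|Succ t s a|)%N.

Lemma ambiguity_in_identified (d : regime T S A) (p : trajectory T S A -> R) :
  ambiguity_set d (default_family (law M) G Succ) p ->
  identified_set d (law M) G Succ p.
Proof.
move=> [_ [q0 [q [/= q0E qE pE]]]].
pose al (t : 'I_T) (s : S t) a := pr (treatment_event s a : set (Omega M)).
(* Only the response to the regime's action is prescribed by [q]; for other actions the response law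
   of [M] is kept, so as to reproduce the data. *)
pose kq (t : 'I_T) (s : S t) (a : A) (s' : S t.+1) := if a == d t s then q t s (d t s) s'
  else pr (response_event s a s' : set (Omega M)).
(* At a state of probability zero the data leave the kernel free, while [q] need
   not dominate the kernel of [M]; forcing the action [d t s] there restores
   [K t s (d t s, s') <= q t s (d t s) s']. *)
pose K (t : 'I_T) (s : S t) (z : A * S t.+1) :=
  if t \notin G then al t s z.1 * kq t s z.1 z.2
  else if state_prob M s == 0 then (z.1 == d t s)%:R * q t s (d t s) z.2
  else kernel M s z.1 z.2.
have {}q0E : q0 = initial M by rewrite q0E; apply/funext => s; rewrite prob_init.
have hq0 : distr q0 by rewrite q0E; exact: initial_distr.
have hq (t : 'I_T) (s : S t) : distr_on (Succ t s (d t s)) (q t s (d t s)).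
  exact: default_distr (qE t s).
have hkq (t : 'I_T) (s : S t) a : distr_on (Succ t s a) (kq t s a).
  rewrite /kq; have [->|_] := eqVneq a (d t s); first exact: hq.
  exact: response_distr.
have hK (t : 'I_T) (s : S t) : distr (K t s).
  rewrite /K; split=> [z|].
    case: ifPn => _; first by rewrite mulr_ge0 ?pr_ge0 //; exact: (hkq t s z.1).1.1.
    case: ifPn => _; first by rewrite mulr_ge0 //; exact: (hq t s).1.1.
    exact: kernel_ge0.
  have [tG|tG] := boolP (t \notin G).
    rewrite (sum_pair_mul (al t s) (g := kq t s)) ?(treatment_distr M s).2 // => a.
    exact: (hkq t s a).1.2.
  have [s0|s0] := boolP (state_prob M s == 0).
    rewrite (sum_pair_mul (fun a => (a == d t s)%:R) (g := fun _ => q t s (d t s))).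
      rewrite (bigD1 (d t s)) //= eqxx big1 ?addr0 // => a /negbTE ->.
      by [].
    by move=> a; exact: (hq t s).1.2.
  rewrite -(pair_bigA _ (fun a s' => kernel M s a s')) /=.
  by under eq_bigr do rewrite sum_kernel; rewrite (treatment_distr M s).2.
have KSucc (t : 'I_T) (s : S t) a s' : s' \notin Succ t s a -> K t s (a, s') = 0.
  move=> s'N; rewrite /K /=; case: ifPn => _; first by rewrite (hkq t s a).2 // mulr0.
  case: ifPn => _.
    have [aE|_] := eqVneq a (d t s); last by rewrite mul0r.
    by rewrite (hq t s).2 ?mulr0 // -aE.
  apply/eqP; rewrite eq_le kernel_ge0 andbT.
  apply: le_trans (kernel_le_response M s a s') _.
  by rewrite (response_distr s a respM).2.
have Kq (t : 'I_T) (s : S t) s' : K t s (d t s, s') <= q t s (d t s) s'.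
  rewrite /K /=; case: ifPn => tG.
    (* Here [K] at the regime's action is [q] times a treatment probability, which is at most
       one. *)
    rewrite /kq eqxx ler_piMl //; first exact: (hq t s).1.1.
    have [al0 al1] := treatment_distr M s.
    by rewrite -al1 (bigD1 (d t s)) //= lerDl sumr_ge0.
  rewrite negbK in tG.
  case: ifPn => s0; first by rewrite eqxx mul1r.
  by apply: default_kernel_le => //; exact: qE.
have Kalkq (t : 'I_T) (s : S t) a s' : t \notin G ->
    K t s (a, s') = al t s a * kq t s a s'.
  by move=> tG; rewrite /K tG.
have kqq (t : 'I_T) (s : S t) s' : t \notin G -> kq t s (d t s) s' = q t s (d t s) s'.
  by move=> _; rewrite /kq eqxx.
have [M' [indM' compM' respM' M'0 [M'K M'q]]] :=
  exists_scm hSucc (q := fun t s => q t s (d t s))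
  hq0 hK KSucc hq Kq (fun t s => treatment_distr M s) hkq Kalkq kqq.
exists M'; last first.
  apply/funext => v; rewrite law_interveneE // pE M'0; congr (_ * _).
  apply: eq_bigr => t _; have [->|_] := eqVneq; last by rewrite !mul0r.
  by rewrite M'q.
(* On a trajectory of positive probability every visited state has positive probability, and there
   [K] agrees with the kernel of [M]. *)
split => //; apply: eq_distr; [exact: law_distr|exact: law_distr|move=> v Pv].
rewrite lawE // [RHS]lawE // M'0 q0E; congr (_ * _).
apply: eq_bigr => t _; rewrite M'K.
set s := state_at v t.
have s0 : state_prob M s != 0.
  rewrite -prob_state /prob (bigD1 v) /=; last by rewrite /at_state eqxx.
  rewrite gt_eqF // ltr_pwDl ?sumr_ge0 //; last by move=> *; exact: (law_distr M).1.
  by rewrite lt_def Pv (law_distr M).1.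
rewrite /K /= (negbTE s0); case: ifPn => // tG.
rewrite /kq; have [aE|_] := eqVneq; last first.
  by rewrite -(unconfounded_kernel indM _ _ _ compM tG).
rewrite aE; apply/esym; apply: default_kernel_unconfounded => //.
Qed.

End DefaultFamily.

Theorem theorem3p8 (R : realType) (T : nat) (hT : (1 <= T)%N)
  (S : nat -> finType) (A : finType) (Y : {fset R}) (y : S T -> Y)
  (G : {set 'I_T})
  (Succ : successors T S A)
  (hSucc : forall (t : 'I_T) (s : S t) (a : A), (0 < #|Succ t s a|)%N)
  (P : trajectory T S A -> R) (hP : distr P)
  (d : regime T S A)
  (hM : exists M : scm R T S A, admissible P G Succ M) :
  ambiguity_set d (default_family P G Succ) = identified_set d P G Succ.
Proof.
apply/seteqP; split=> p.
  (* A model with law [P] supplies the kernels from which the new model is built; in the reverse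
     inclusion the model comes with the point of the identified set. *)
  have [M [indM <- compM respM]] := hM.
  exact: ambiguity_in_identified.
move=> [M [indM <- compM respM] ->].
exact: identified_in_ambiguity.
Qed.
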